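(* If $\Phi \subseteq 2^E$ is an interval with vertex $e \in E$, then the reduction $\Phi \| e$ is again an interval.
   Context: $E$ is a finite set and $2^E$ its Boolean algebra of subsets. A set $\Phi \subseteq 2^E$ is an interval if $F \subseteq G \subseteq H$ and $F,H \in \Phi$ imply $G \in \Phi$. Elements of $E$ are the vertices of $\Phi$ (a vertex need not lie in any member of $\Phi$). For $e \in E$, the star is $\mathrm{st}_\Phi e = \bigcup \{F, F \cup \{e\}\}$, the union over all $F$ with $e \notin F$ and $F, F\cup\{e\} \in \Phi$, and the reduction is $\Phi \| e = \Phi \setminus \mathrm{st}_\Phi e$. *)

(* Defs.v *)
From mathcomp Require Import all_boot.

Set Implicit Arguments.
Unset Strict Implicit.
Unset Printing Implicit Defensive.

Definition is_interval (E : finType) (Phi : {set {set E}}) : Prop :=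
  forall F G H : {set E},
    F \subset G -> G \subset H -> F \in Phi -> H \in Phi -> G \in Phi.

Definition star (E : finType) (Phi : {set {set E}}) (e : E) : {set {set E}} :=
  \bigcup_(F : {set E} | [&& e \notin F, F \in Phi & e |: F \in Phi])
    [set F; e |: F].

Definition reduction (E : finType) (Phi : {set {set E}}) (e : E) :
    {set {set E}} :=
  Phi :\: star Phi e.

(* Main.v *)
(* A set G lies in the star of e iff both G \ {e} and G + e lie in Phi.  If this
   holds for F <= G <= H, it passes to H when e is in H, since
   G \ {e} <= H \ {e} <= H, and to F otherwise, since F <= F + e <= G + e. *)
Require Import Defs.
From mathcomp Require Import all_boot.

(** A pair [[set F; e |: F]] with e outside F can contain G only if F is [G :\ e]; G is then the
    upper member when it contains e and the lower one otherwise. *)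
Lemma in_star (E : finType) (Phi : {set {set E}}) (e : E) (G : {set E}) :
  (G \in star Phi e) = (G :\ e \in Phi) && (e |: G \in Phi).
Proof.
apply/bigcupP/andP => [[F /and3P[eF FPhi eFPhi]] | [GPhi eGPhi]].
  by rewrite !inE => /orP[] /eqP->; rewrite ?setU1K // ?setUA ?setUid;
     split=> //; rewrite (setDidPl _) // disjoint_sym disjoints1.
have eGe : e |: G :\ e = e |: G by apply/setP=> x; rewrite !inE; case: eqP.
exists (G :\ e); first by rewrite setD11 GPhi eGe.
rewrite !inE eGe; have [eG | eG] := boolP (e \in G).
  by rewrite [e |: G](setUidPr _) ?sub1set // eqxx orbT.
by rewrite (setDidPl _) ?eqxx // disjoint_sym disjoints1.
Qed.

Theorem lemma2p4 (E : finType) (Phi : {set {set E}}) (e : E)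
    (hPhi : is_interval Phi) :
  is_interval (reduction Phi e).
Proof.
move=> F G H FG GH /setDP[FPhi FNstar] /setDP[HPhi HNstar].
apply/setDP; split; first exact: hPhi FG GH FPhi HPhi.
(* If G were in the star, so would be F or H, and both lie outside it. *)
rewrite in_star; apply/andP=> -[GPhi eGPhi].
have [eH | eH] := boolP (e \in H).
  move/negP: HNstar; apply; rewrite in_star; apply/andP; split.
    exact: hPhi (setSD _ GH) (subsetDl _ _) GPhi HPhi.
  by rewrite (setUidPr _) ?sub1set.
(* As F misses e along with H, [F :\ e] is F itself, and only [e |: F] needs the interval
   property. *)
have eF : e \notin F by apply: contra eH; apply: subsetP (subset_trans FG GH) e.
move/negP: FNstar; apply; rewrite in_star; apply/andP; split.
  by rewrite (setDidPl _) // disjoint_sym disjoints1.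
exact: hPhi (subsetUr _ _) (setUS _ FG) FPhi eGPhi.
Qed.
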